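(* Let $q$ be a prime power, let $\beta\in\mu_{q+1}$ and let $d$ be a positive integer. Let $H,L,M\in\mathbb{F}_{q^2}[x]$ be such that $H$ is monic of degree $n$, and $L$ and $M$ are both $(\beta,d)$-self-associated. Suppose that (i) $L/M$ is a bijection from $\mu_{q+1}$ onto $\mathbb{F}_q\cup\{\infty\}$; (ii) the algebraic curve $\prod_{\xi\in\mathbb{F}_q}(H(x)-\xi H(y))=0$ has no affine $\mathbb{F}_q$-rational points off the line $x=y$ (that is, there are no $(a,b)\in\mathbb{F}_q^2$ with $a\ne b$ and $H(a)=\xi H(b)$ for some $\xi\in\mathbb{F}_q$); (iii) $H^{\sigma}-H$ has no roots in $\mathbb{F}_q$ (that is, $H^\sigma(a)\neq H(a)$ for every $a\in\mathbb{F}_q$). Then for any integer $k\ge 0$, the polynomial $x^{dn+k(q+1)}\,(H\bullet L/M)(x^{q-1})$ permutes $\mathbb{F}_{q^2}$ if and only if $\gcd(dn+k(q+1),\,q-1)=1$.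
   Context: $\mu_{q+1}=\{x\in\mathbb{F}_{q^2}: x^{q+1}=1\}$. A polynomial permutes $\mathbb{F}_{q^2}$ if the induced map $\mathbb{F}_{q^2}\to\mathbb{F}_{q^2}$ is a bijection. For $\beta\in\mu_{q+1}$ and $t\in\mathbb{N}=\{1,2,\dots\}$, a polynomial $P\in\mathbb{F}_{q^2}[x]$ is $(\beta,t)$-self-associated if $P(x)^q=\beta x^{-t}P(x)$ for every $x\in\mu_{q+1}$. For $H(x)=\sum_{i=0}^n\alpha_i x^i\in\mathbb{F}_{q^2}[x]$ of degree $n$, $H^\sigma(x)=\sum_{i=0}^n\alpha_i^q x^i$, and $H\bullet L/M:=M^{n}H(L/M)=\sum_{i=0}^n\alpha_i L^iM^{n-i}$. In (i), $L$ and $M$ have no common root in $\mu_{q+1}$, and $L(x)/M(x)$ is taken to be $\infty$ when $M(x)=0$. *)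

(* Defs.v *)
From mathcomp Require Import all_boot all_order all_algebra.
Set Implicit Arguments.
Unset Strict Implicit.
Unset Printing Implicit Defensive.
Import GRing.Theory.
Local Open Scope ring_scope.

(* Throughout, F plays the role of the field with q ^ 2 elements. *)

Definition prime_power (q : nat) : Prop :=
  exists p m : nat, [/\ prime p, (0 < m)%N & q = (p ^ m)%N].

(* The subfield of order q of F, as the fixed points of x |-> x ^+ q. *)
Definition Fq (F : finFieldType) (q : nat) : {set F} :=
  [set x | x ^+ q == x].

Definition mu (F : finFieldType) (m : nat) : {set F} :=
  [set x | x ^+ m == 1].

Definition permutes (F : finFieldType) (P : {poly F}) : Prop :=
  bijective (fun x : F => P.[x]).

Definition self_associated (F : finFieldType) (q : nat) (beta : F) (t : nat)
    (P : {poly F}) : Prop :=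
  forall x : F, x \in mu F q.+1 -> P.[x] ^+ q = beta * x ^- t * P.[x].

Definition sigma (F : finFieldType) (q : nat) (H : {poly F}) : {poly F} :=
  map_poly (fun a : F => a ^+ q) H.

(* The homogenized composition M ^ n * H (L / M), with n = (size H).-1 the
   degree of H. *)
Definition bullet (F : finFieldType) (H L M : {poly F}) : {poly F} :=
  \sum_(i < size H) H`_i *: (L ^+ i * M ^+ ((size H).-1 - i)).

(* Values in F together with a point at infinity, represented by None. *)
Definition ratio_map (F : finFieldType) (L M : {poly F}) (x : F) : option F :=
  if M.[x] == 0 then None else Some (L.[x] / M.[x]).

Definition P1Fq (F : finFieldType) (q : nat) : {set option F} :=
  None |: [set Some a | a in Fq F q].

Definition bijection_onto (S T : finType) (f : S -> T) (A : {set S})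
    (B : {set T}) : Prop :=
  {in A &, injective f} /\ f @: A = B.

(* In {poly {poly F}}, map_poly polyC H is H in the outer variable x, while
   H%:P is H in the inner variable y. *)
Definition curve (F : finFieldType) (q : nat) (H : {poly F}) :
    {poly {poly F}} :=
  \prod_(xi in Fq F q) (map_poly polyC H - xi%:P%:P * H%:P).

Definition affine_rational_point (F : finFieldType) (q : nat)
    (C : {poly {poly F}}) (a b : F) : Prop :=
  [/\ a \in Fq F q, b \in Fq F q & C.[a%:P].[b] = 0].

(* Main.v *)
Require Import Defs.
From mathcomp Require Import all_boot all_order all_algebra.
From mathcomp Require Import all_field.
Import GRing.Theory.
Local Open Scope ring_scope.

(** Let [P] be the polynomial of the theorem and [r = d n + k (q + 1)].  For
    [x <> 0] put [z = x ^ (q - 1)], an element of [mu_(q+1)].  Self-association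
    gives [L(z) ^ (q - 1) = M(z) ^ (q - 1) = beta z ^ (- d)] whenever the left
    sides are nonzero, so that [P(x) ^ (q - 1)] is [beta ^ n] times
    [H(a) ^ (q - 1)] if [a = L(z) / M(z)] is finite, and [beta ^ n] itself if
    [L(z) / M(z)] is infinite.  By (iii) the value [H(a) ^ (q - 1)] is never
    [1], and by (ii) it determines [a]; hence by (i) [P(x) ^ (q - 1)]
    determines [z].  On a fibre [x ^ (q - 1) = z] the polynomial [P] is
    [x ^ r] up to a nonzero factor, which is injective exactly when
    [gcd (r, q - 1) = 1]. *)

Set Implicit Arguments.
Unset Strict Implicit.

Set Implicit Arguments.
Unset Strict Implicit.

Set Implicit Arguments.
Unset Strict Implicit.

Set Implicit Arguments.
Unset Strict Implicit.

Set Implicit Arguments.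
Unset Strict Implicit.

Section Bullet.

Variables (F : finFieldType) (H L M : {poly F}) (z : F).

Lemma horner_bullet : M.[z] != 0 ->
  (bullet H L M).[z] = M.[z] ^+ (size H).-1 * H.[L.[z] / M.[z]].
Proof.
move=> Mz; rewrite /bullet horner_sum (horner_coef H) mulr_sumr.
apply: eq_bigr => i _ /=; rewrite hornerZ hornerM !horner_exp.
have le_i : (i <= (size H).-1)%N by case: (size H) i => [[]|m []].
rewrite [RHS]mulrCA expr_div_n; congr (_ * _).
rewrite -[in RHS](subnK le_i) exprD.
rewrite -mulrA [X in _ = _ * X]mulrCA.
by rewrite divff ?expf_neq0 // mulr1 mulrC.
Qed.

(** Only the top term of the sum carries [M] to the power 0; every other term vanishes with
    [M.[z]]. *)
Lemma horner_bullet_root : M.[z] = 0 ->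
  (bullet H L M).[z] = lead_coef H * L.[z] ^+ (size H).-1.
Proof.
move=> Mz; rewrite /bullet horner_sum lead_coefE.
case sz: (size H) => [|m] /=.
  by rewrite big_ord0 nth_default ?sz // mul0r.
rewrite big_ord_recr /= big1 ?add0r => [|i _]; rewrite hornerZ hornerM !horner_exp Mz.
  by rewrite subnn expr0 mulr1.
by rewrite expr0n subn_eq0 leqNgt ltn_ord !mulr0.
Qed.

End Bullet.

Lemma horner_curve (F : finFieldType) (q : nat) (H : {poly F}) (a b : F) :
  (curve q H).[a%:P].[b] = \prod_(xi in Fq F q) (H.[a] - xi * H.[b]).
Proof.
rewrite /curve !horner_prod; apply: eq_bigr => xi _.
by rewrite !hornerE horner_map !hornerE.
Qed.

(** The ratio [x / y] is both an [m]-th and an [n]-th root of unity; the Bezout relation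
    [km * m = kn * n + 1] forces it to be 1. *)
Lemma eq_of_coprime_exp (F : fieldType) (m n : nat) (x y : F) :
  (0 < m)%N -> coprime m n -> y != 0 ->
  x ^+ m = y ^+ m -> x ^+ n = y ^+ n -> x = y.
Proof.
move=> m_gt0 co_mn y0 xm xn; apply: (divIf y0); rewrite divff //.
have um : (x / y) ^+ m = 1 by rewrite expr_div_n xm divff ?expf_neq0.
have un : (x / y) ^+ n = 1 by rewrite expr_div_n xn divff ?expf_neq0.
case: (egcdnP n m_gt0) => km kn e _; rewrite (eqP co_mn) addn1 in e.
have: (x / y) ^+ (km * m) = 1 by rewrite mulnC exprM um expr1n.
by rewrite e exprS mulnC exprM un expr1n mulr1.
Qed.

(** Write [#|F|.-1 = g * e]. At most [g] of these nonzero elements satisfy [x ^+ g = 1], so some [x]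
    does not, and [w = x ^+ g] works. *)
Lemma nontrivial_unity_root (F : finFieldType) (e : nat) :
  (1 < e)%N -> (e %| #|F|.-1)%N -> exists2 w : F, w != 1 & w ^+ e = 1.
Proof.
move=> e_gt1 /dvdnP[g def_card].
have card_gt0 : (0 < #|F|.-1)%N by rewrite -subn1 subn_gt0 finNzRing_gt1.
have g_gt0 : (0 < g)%N by case: g def_card card_gt0 => // ->.
have [x x0 xg] : exists2 x : F, x != 0 & x ^+ g != 1.
  suff /existsP[x /andP[]] : [exists x : F, (x != 0) && (x ^+ g != 1)].
    by exists x.
  apply: contraT; rewrite negb_exists => /forallP all1.
  have := @max_unity_roots F g (enum (predC1 (0 : F))) g_gt0.
  rewrite -cardE enum_uniq cardC1 def_card -[leqRHS]muln1 leq_pmul2l // leqNgt e_gt1.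
  apply=> //; apply/allP => x; rewrite mem_enum unity_rootE inE => x0.
  by have := all1 x; rewrite x0 negbK.
exists (x ^+ g) => //.
rewrite -exprM -def_card.
apply: (mulfI x0); rewrite mulr1 -exprS prednK ?expf_card //.
by apply: ltnW; apply: finNzRing_gt1.
Qed.

Lemma prime_power_gt0 (q : nat) : prime_power q -> (0 < q)%N.
Proof. by case=> p [m [/prime_gt0 p_gt0 _ ->]]; rewrite expn_gt0 p_gt0. Qed.

Section QuadraticExtension.

Variables (q : nat) (F : finFieldType).
Hypotheses (q_pp : prime_power q) (cardF : #|F| = (q ^ 2)%N).

Let q_gt0 : (0 < q)%N := prime_power_gt0 q_pp.

(** This makes [x ^+ q] additive on [F]. *)
Lemma pchar_nat_prime_power : [pchar F].-nat q.
Proof.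
have [p [m [p_pr m_gt0 q_eq]]] := q_pp.
have pcharFp : p \in [pchar F].
  by apply: (@card_finPcharP _ p (m * 2)) => //; rewrite cardF q_eq expnM.
by rewrite q_eq (eq_pnat _ (pcharf_eq pcharFp)) pnatX pnat_id.
Qed.

Lemma horner_sigma (H : {poly F}) (a : F) : a \in Fq F q ->
  (sigma q H).[a] = H.[a] ^+ q.
Proof.
rewrite inE => /eqP aq.
have expq0 : (0 : F) ^+ q = 0 by rewrite expr0n gtn_eqF.
have expqD (x y : F) : (x + y) ^+ q = x ^+ q + y ^+ q.
  exact: exprDn_pchar pchar_nat_prime_power.
(* Expanding [sigma q H] up to [size H] needs only a bound on its size and aligns the two sums term
   by term. *)
rewrite (horner_coef_wide a (size_poly _ _)) horner_coef.
rewrite (big_morph (fun x => x ^+ q) expqD expq0).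
by apply: eq_bigr => i _; rewrite coef_poly ltn_ord exprMn exprAC aq.
Qed.

Lemma card_pred : #|F|.-1 = ((q - 1) * q.+1)%N.
Proof. by rewrite cardF -subn1 -[X in (_ - X)%N](exp1n 2) subn_sqr addn1. Qed.

Lemma exp_pred_mu (x : F) : x != 0 -> x ^+ (q - 1) \in mu F q.+1.
Proof.
move=> x0; rewrite inE -exprM -card_pred; apply/eqP/(mulfI x0).
by rewrite mulr1 -exprS prednK ?expf_card // cardF expn_gt0 q_gt0.
Qed.

Lemma mu_neq0 (z : F) : z \in mu F q.+1 -> z != 0.
Proof.
by rewrite inE; apply: contraTneq => ->; rewrite expr0n eq_sym oner_eq0.
Qed.

Lemma exp_pred_eq1_Fq (x : F) : x ^+ (q - 1) = 1 -> x \in Fq F q.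
Proof. by move=> x1; rewrite inE -[q in x ^+ q](subnK q_gt0) exprD x1 mul1r. Qed.

Lemma self_associated_exp_pred (beta : F) (d : nat) (P : {poly F}) (z : F) :
  self_associated q beta d P -> z \in mu F q.+1 -> P.[z] != 0 ->
  P.[z] ^+ (q - 1) = beta * z ^- d.
Proof.
move=> hP hz Pz; apply: (mulIf Pz).
by rewrite -[in LHS]exprSr subn1 prednK // hP.
Qed.

Section Values.

Variable H : {poly F}.
Hypotheses
  (H_curve : forall a b : F, affine_rational_point q (curve q H) a b -> a = b)
  (H_sigma : forall a : F, a \in Fq F q -> ~ root (sigma q H - H) a).

(** Since the conjugate polynomial takes the value [H.[a] ^+ q] at [a], hypothesis (iii) says that
    [H] maps no point of the subfield into the subfield. *)
Lemma sigma_exp_neq (a : F) : a \in Fq F q -> H.[a] ^+ q != H.[a].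
Proof.
move=> ha; apply/negP => /eqP Ha; apply: (H_sigma ha).
by rewrite rootE !hornerE horner_sigma // Ha subrr.
Qed.

Lemma H_neq0 (a : F) : a \in Fq F q -> H.[a] != 0.
Proof.
by move/sigma_exp_neq; apply: contraNneq => ->; rewrite expr0n gtn_eqF.
Qed.

(* The value of [(H^sigma . L/M) / (H . L/M)] where [L/M = a]. *)
Definition quotient_value (a : option F) : F :=
  oapp (fun a => H.[a] ^+ (q - 1)) 1 a.

Lemma exp_pred_H_neq1 (a : F) : a \in Fq F q -> H.[a] ^+ (q - 1) != 1.
Proof.
move=> ha; have := sigma_exp_neq ha; apply: contraNneq.
by move/exp_pred_eq1_Fq; rewrite inE.
Qed.

(** The value 1 at infinity is never taken at a finite point. If two finite values agree, [H.[a] /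
    H.[b]] lies in the subfield, so [(a, b)] is on the curve and (ii) applies. *)
Lemma quotient_value_inj : {in P1Fq F q &, injective quotient_value}.
Proof.
have P1P (c : option F) : c \in P1Fq F q ->
    c = None \/ exists2 a, a \in Fq F q & c = Some a.
  by case/setU1P => [->|/imsetP[a ha ->]]; [left | right; exists a].
move=> _ _ /P1P[->|[a ha ->]] /P1P[->|[b hb ->]] //= e.
- by have := exp_pred_H_neq1 hb; rewrite -e eqxx.
- by have := exp_pred_H_neq1 ha; rewrite e eqxx.
congr Some; apply: H_curve; split=> //; rewrite horner_curve.
have Hb := H_neq0 hb.
(* The factor of index [xi = H.[a] / H.[b]] is the one that vanishes. *)
rewrite (bigD1 (H.[a] / H.[b])) /= ?divfK ?subrr ?mul0r //.
by apply: exp_pred_eq1_Fq; rewrite expr_div_n e divff ?expf_neq0.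
Qed.

Variables (beta : F) (d : nat) (L M : {poly F}).
Hypotheses (Hmonic : H \is monic)
  (hL : self_associated q beta d L) (hM : self_associated q beta d M)
  (LM_coprime : forall x : F, x \in mu F q.+1 -> ~ (root L x /\ root M x))
  (LM_into : forall x : F, x \in mu F q.+1 -> ratio_map L M x \in P1Fq F q).

Lemma bullet_exp_pred (z : F) : z \in mu F q.+1 ->
  (bullet H L M).[z] != 0 /\
  (bullet H L M).[z] ^+ (q - 1) =
    (beta * z ^- d) ^+ (size H).-1 * quotient_value (ratio_map L M z).
Proof.
move=> hz; have := LM_into hz; rewrite /ratio_map.
case: eqP => [Mz _|/eqP Mz].
  have Lz : L.[z] != 0.
    by apply/negP => Lz; apply: (LM_coprime hz); rewrite !rootE Lz Mz.
  rewrite horner_bullet_root // (monicP Hmonic) mul1r expf_neq0 //; split=> //.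
  by rewrite exprAC (self_associated_exp_pred hL) //= mulr1.
case/setU1P => // /imsetP[a ha [aE]]; rewrite horner_bullet // aE /=.
rewrite mulf_neq0 ?expf_neq0 ?H_neq0 //; split=> //.
by rewrite exprMn exprAC (self_associated_exp_pred hM).
Qed.

End Values.

End QuadraticExtension.

Unset Implicit Arguments.

Theorem theorem5p1 (q : nat) (hq : prime_power q)
  (F : finFieldType) (hF : #|F| = (q ^ 2)%N)
  (beta : F) (hbeta : beta \in mu F q.+1)
  (d : nat) (hd : (0 < d)%N)
  (n : nat) (H L M : {poly F})
  (Hmonic : H \is monic) (Hdeg : size H = n.+1)
  (hL : self_associated q beta d L) (hM : self_associated q beta d M)
  (LM_coprime : forall x : F, x \in mu F q.+1 -> ~ (root L x /\ root M x))
  (LM_bij : bijection_onto (ratio_map L M) (mu F q.+1) (P1Fq F q))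
  (H_curve : forall a b : F,
     affine_rational_point q (curve q H) a b -> a = b)
  (H_sigma : forall a : F, a \in Fq F q -> ~ root (sigma q H - H) a)
  (k : nat) :
  permutes ('X^(d * n + k * q.+1) * (bullet H L M \Po 'X^(q - 1))) <->
  gcdn (d * n + k * q.+1) (q - 1) = 1%N.
Proof.
set B := bullet H L M; set r := (d * n + k * q.+1)%N.
have [ratio_inj ratio_im] := LM_bij.
have q_gt1 : (1 < q)%N.
  by case: hq => p [m [/prime_gt1 p1 m0 ->]]; rewrite -(exp1n m) ltn_exp2r.
have ratio_into x : x \in mu F q.+1 -> ratio_map L M x \in P1Fq F q.
  by move=> hx; rewrite -ratio_im imset_f.
have BP := bullet_exp_pred hq hF H_sigma Hmonic hL hM LM_coprime ratio_into.
rewrite Hdeg /= -/B in BP.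
have PE x : ('X^r * (B \Po 'X^(q - 1))).[x] = x ^+ r * B.[x ^+ (q - 1)].
  by rewrite !hornerE horner_comp !hornerE.
have P_exp x : x != 0 -> (x ^+ r * B.[x ^+ (q - 1)]) ^+ (q - 1) =
    beta ^+ n * quotient_value q H (ratio_map L M (x ^+ (q - 1))).
  move=> x0; set z := x ^+ (q - 1).
  have hz : z \in mu F q.+1 by apply: exp_pred_mu.
  have z0 := mu_neq0 hz.
  (* The part [k * q.+1] of the exponent disappears because [z ^+ q.+1 = 1]; what remains cancels
     the factor [z ^- d] raised to [n]. *)
  have zr : z ^+ r = z ^+ (d * n).
    move: hz; rewrite inE => /eqP hz.
    by rewrite /r exprD mulnC [(k * _)%N]mulnC [_ ^+ (q.+1 * k)]exprM hz expr1n mulr1.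
  rewrite exprMn exprAC -/z zr (BP z hz).2 exprMn exprVn exprM mulrA.
  by rewrite mulrCA divff ?mulr1 // !expf_neq0.
have beta0 := mu_neq0 hbeta.
(* If [n] were 0, then [H] would be the constant 1, against (iii) at the point 0. Positivity of [r]
   ensures that the polynomial vanishes at 0. *)
have r_gt0 : (0 < r)%N.
  have Fq0 : 0 \in Fq F q by rewrite inE expr0n gtn_eqF // ltnW.
  rewrite addn_gt0 muln_gt0 hd lt0n; apply/orP; left.
  apply: contraTneq (sigma_exp_neq hq hF H_sigma Fq0) => n0.
  have /size_poly1P[c _ Hc] : size H == 1%N by rewrite Hdeg n0.
  by move: Hmonic; rewrite Hc monicE lead_coefC => /eqP->; rewrite hornerC expr1n eqxx.
have BN0 x : x != 0 -> B.[x ^+ (q - 1)] != 0.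
  by move=> x0; apply: (BP _ _).1; apply: exp_pred_mu.
split=> [[g gK _]|r_co].
  apply/eqP; rewrite eqn_leq gcdn_gt0 subn_gt0 q_gt1 orbT andbT leqNgt.
  apply/negP => gcd_gt1.
  (* Both [w ^+ r] and [w ^+ (q - 1)] equal 1, so the polynomial takes the same value at [w] and at
     1. *)
  have [|w w_neq1 we] := @nontrivial_unity_root F _ gcd_gt1.
    by rewrite (card_pred hF) dvdn_mulr // dvdn_gcdr.
  apply/negP: w_neq1; rewrite negbK; apply/eqP/(can_inj gK); rewrite !PE.
  have w1 m : (gcdn r (q - 1) %| m)%N -> w ^+ m = 1.
    by case/dvdnP=> c ->; rewrite mulnC exprM we expr1n.
  by rewrite !w1 ?expr1n ?dvdn_gcdl ?dvdn_gcdr.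
apply: injF_bij => x y; rewrite !PE => Pxy.
have P0 : 0 ^+ r * B.[0 ^+ (q - 1)] = 0 by rewrite expr0n gtn_eqF // mul0r.
have zero_only u : u ^+ r * B.[u ^+ (q - 1)] = 0 -> u = 0.
  have [//|u0] := eqVneq u 0.
  by move/eqP; rewrite mulf_eq0 expf_eq0 (negPf u0) (negPf (BN0 u u0)) andbF.
have [x0|x0] := eqVneq x 0; first by rewrite x0 P0 in Pxy; rewrite x0 (zero_only y).
have [y0|y0] := eqVneq y 0; first by rewrite y0 P0 in Pxy; rewrite y0 (zero_only x).
(* After cancelling [beta ^+ n], equal values give equal quotient values, hence equal ratios
   [L / M], hence equal points of [mu F q.+1]. *)
have zxy : x ^+ (q - 1) = y ^+ (q - 1).
  apply: ratio_inj; rewrite ?exp_pred_mu //.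
  apply: (quotient_value_inj hq hF H_curve H_sigma);
    rewrite ?ratio_into ?exp_pred_mu //.
  by apply: (mulfI (expf_neq0 n beta0)); rewrite -!P_exp // Pxy.
(* On a common fibre the nonzero factor [B] is the same for [x] and [y], which leaves
   [x ^+ r = y ^+ r]. *)
apply: (eq_of_coprime_exp r_gt0 _ y0 _ zxy).
  exact/eqP.
by apply: (mulIf (BN0 y y0)); rewrite -[in LHS]zxy.
Qed.
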